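(* Let $p\ge 2$ be an integer. For each integer $N\ge p$ define the rational number $$\zeta_{N}(p)=\sum_{n=0}^{4N}\frac{S_n^p}{n+1}N^{n+1}+\sum_{n=0}^{N-p}\frac{(-1)^n s(n+p-1,p-1)}{(n+p-1)N^{n+p-1}}.$$ Then there exists a constant $C>0$ such that for all sufficiently large $N$, $$|\zeta(p)-\zeta_{N}(p)|\le C N e^{-N},$$ where $\zeta$ is the Riemann zeta function.
   Context: $S_n^p=\frac{(-1)^n}{n!}\sum_{k=0}^{n}\frac{(-1)^{k}\binom{n}{k}}{(k+1)^p}$ (generalized Stirling numbers of the second kind). $s(n,k)$ are the Stirling numbers of the first kind, defined by $\frac{\ln^k(1+t)}{k!}=\sum_{n=k}^{\infty}s(n,k)\frac{t^n}{n!}$ for $|t|<1$. *)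

(* Defs.v *)
From HB Require Import structures.
From mathcomp Require Import all_boot all_order all_algebra.
From mathcomp Require Import all_classical all_reals all_analysis.
From mathcomp Require Import ring lra.

Set Implicit Arguments.
Unset Strict Implicit.
Unset Printing Implicit Defensive.

Import Order.TTheory GRing.Theory Num.Theory.
Import numFieldNormedType.Exports.

Local Open Scope classical_set_scope.
Local Open Scope ring_scope.

Definition gen_stirling2 (p n : nat) : rat :=
  (-1) ^+ n / n`!%:R *
  \sum_(0 <= k < n.+1) ((-1) ^+ k * 'C(n, k)%:R / k.+1%:R ^+ p).

(** The generating function determines [s n k] for [k <= n]; the values with
    [n < k] are left unconstrained. *)
Definition is_stirling1 (R : realType) (s : nat -> nat -> rat) : Prop :=
  forall (k : nat) (t : R), `|t| < 1 ->
    (fun m : nat => \sum_(k <= n < m) (ratr (s n k) * (t ^+ n / n`!%:R))) @ \oo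
      --> ln (1 + t) ^+ k / k`!%:R.

(** Only meaningful for [2 <= p], where the series converges. *)
Definition zeta (R : realType) (p : nat) : R :=
  limn (series (fun n : nat => (n.+1%:R ^+ p)^-1 : R)).

(** The truncated subtraction in the bound of the second sum is a genuine
    one when [p <= N]. *)
Definition zeta_approx (s : nat -> nat -> rat) (p N : nat) : rat :=
  \sum_(0 <= n < (4 * N).+1) (gen_stirling2 p n / n.+1%:R * N%:R ^+ n.+1)
  + \sum_(0 <= n < (N - p).+1)
      ((-1) ^+ n * s (n + p - 1)%N (p - 1)%N
        / ((n + p - 1)%:R * N%:R ^+ (n + p - 1))).

(** [is_stirling1] is satisfiable: the sequence given by the usual recurrence
    has the required generating function. *)
Module Stirling1Existence.

Fixpoint stirling1 (n k : nat) : rat :=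
  match n, k with
  | 0, 0 => 1
  | 0, _.+1 => 0
  | m.+1, 0 => - m%:R * stirling1 m 0
  | m.+1, j.+1 => stirling1 m j - m%:R * stirling1 m j.+1
  end.

Lemma stirling1_small n k : (n < k)%N -> stirling1 n k = 0.
Proof.
elim: n k => [|n IH] [|k] //= nk.
by rewrite !IH ?mulr0 ?subr0 // ltnW.
Qed.

Lemma stirling1_0 n : stirling1 n.+1 0 = 0.
Proof.
elim: n => [|n IH] /=; first by rewrite oppr0 mul0r.
by rewrite -/(stirling1 n.+1 0) IH mulr0.
Qed.

Lemma stirling1_le n k : `|stirling1 n k| <= n`!%:R.
Proof.
elim: n k => [|n IH] [|k] /=; rewrite ?normr1 ?normr0 //.
- rewrite normrM normrN normr_nat factS natrM.
  by apply: ler_pM => //; rewrite ler_nat.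
- rewrite (le_trans (ler_normB _ _))// normrM normr_nat factS mulSn natrD natrM.
  by rewrite lerD// ler_wpM2l.
Qed.

Section Gen.
Variable R : realType.
Let c k n : R := ratr (stirling1 n k) / n`!%:R.

Lemma c_le k n : `|c k n| <= 1.
Proof.
rewrite /c normrM normfV normr_nat ler_pdivrMr ?ltr0n ?fact_gt0// mul1r.
by rewrite -(ratr_nat R n`!) -ratr_norm ler_rat stirling1_le.
Qed.

Lemma c_diffs k n : pseries_diffs (c k.+1) n = c k n - n%:R * c k.+1 n.
Proof.
rewrite /pseries_diffs /c /= rmorphB rmorphM /= ratr_nat factS natrM.
have := fact_gt0 n; rewrite -(ltr0n R) => /lt0r_neq0 n0.
by field; rewrite n0 nat1r pnatr_eq0.
Qed.

Lemma cvg_c k (x : R) : `|x| < 1 -> cvgn (pseries (c k) x).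
Proof.
move=> x1; apply: normed_cvg.
apply: (@series_le_cvg _ _ (geometric 1 `|x|)) => [n|n|n|] /=.
- by rewrite normr_ge0.
- by rewrite mul1r exprn_ge0.
- by rewrite normrM normrX ler_wpM2r ?exprn_ge0 ?c_le.
- by apply: is_cvg_geometric_series; rewrite normr_id.
Qed.

Lemma cvg_nq (q : R) : 0 <= q -> q < 1 ->
  cvgn (series (fun n : nat => n.+1%:R * q ^+ n)).
Proof.
move=> q0 q1; apply: nondecreasing_is_cvgn.
  by apply: nondecreasing_series => n _ _; rewrite mulr_ge0 ?exprn_ge0.
exists ((1 - q) ^- 2) => _ [n _ <-].
have q10 : 0 < 1 - q by rewrite subr_gt0.
rewrite -(ler_pM2r (exprn_gt0 2 q10)) mulVf ?expf_neq0 ?gt_eqF//.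
suff -> : series (fun n : nat => n.+1%:R * q ^+ n) n * (1 - q) ^+ 2
   = 1 - q ^+ n * (1 + n%:R * (1 - q)).
  by rewrite gerBl mulr_ge0 ?exprn_ge0 ?addr_ge0 ?mulr_ge0// ltW.
elim: n => [|n IH]; first by rewrite /series /= big_nil !(expr0, mul0r) addr0 mulr1 subrr.
rewrite seriesSr mulrDl IH [q ^+ n.+1]exprS -natr1 /=; ring.
Qed.

Lemma cvg_diffs (f : R^nat) (z x : R) :
  cvgn (pseries f z) -> `|x| < `|z| -> cvgn (pseries (pseries_diffs f) x).
Proof.
move=> Cz xz; have z0 : 0 < `|z| by rewrite (le_lt_trans _ xz).
have [K [Kreal Kf]] := cvg_series_bounded Cz.
pose M := `|K| + 1.
have fM n : `|f n * z ^+ n| <= M.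
  by apply: Kf => //; rewrite (le_lt_trans (ler_norm K))// ltrDl.
have M0 : 0 <= M by rewrite addr_ge0.
pose q := `|x| / `|z|.
have q0 : 0 <= q by rewrite divr_ge0.
have q1 : q < 1 by rewrite ltr_pdivrMr// mul1r.
apply: normed_cvg.
apply: (@series_le_cvg _ _ ((M / `|z|) *: (fun n : nat => n.+1%:R * q ^+ n))).
- by move=> n /=.
- by move=> n; rewrite /GRing.scale/= !mulr_ge0 ?invr_ge0 ?exprn_ge0 .
- move=> n; rewrite -[leRHS]/((M / `|z|) * (n.+1%:R * q ^+ n)) /= /pseries_diffs.
  rewrite !normrM normr_nat normrX.
  rewrite (_ : M / _ * _ = n.+1%:R * (M / `|z| ^+ n.+1) * `|x| ^+ n); last first.
    rewrite /q exprMn exprVn exprS invfM; ring.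
  rewrite ler_wpM2r ?exprn_ge0// ler_wpM2l//.
  by rewrite ler_pdivlMr ?exprn_gt0// -normrX -normrM.
- by apply: is_cvg_seriesZ; apply: cvg_nq.
Qed.

Lemma between (x : R) : `|x| < 1 -> exists2 y : R, `|x| < `|y| & `|y| < 1.
Proof.
move=> x1; have [a b] := midf_lt x1.
have h : 0 <= (`|x| + 1) / 2 by rewrite divr_ge0// addr_ge0.
by exists ((`|x| + 1) / 2); rewrite (ger0_norm h).
Qed.

Lemma cvg_dc k (x : R) : `|x| < 1 -> cvgn (pseries (pseries_diffs (c k)) x).
Proof.
by move=> /between[y xy /(@cvg_c k _) Cy]; exact: cvg_diffs Cy xy.
Qed.

Lemma cvg_ddc k (x : R) :
  `|x| < 1 -> cvgn (pseries (pseries_diffs (pseries_diffs (c k))) x).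
Proof.
by move=> /between[y xy /(@cvg_dc k _) Cy]; exact: cvg_diffs Cy xy.
Qed.

Let g k (x : R) := limn (pseries (c k) x).
Let dg k (x : R) := limn (pseries (pseries_diffs (c k)) x).

Lemma g_derive k (x : R) : `|x| < 1 -> is_derive x 1 (g k) (dg k x).
Proof.
move=> /between[y xy y1].
by apply: (pseries_snd_diffs (@cvg_c k _ y1) (@cvg_dc k _ y1) (@cvg_ddc k _ y1) xy).
Qed.

Lemma dgE k (x : R) : `|x| < 1 -> (1 + x) * dg k.+1 x = g k x.
Proof.
move=> x1; have Cd := @cvg_dc k.+1 _ x1.
have E := pseries_diffs_equiv Cd.
have h : pseries (c k) x @ \oo --> dg k.+1 x + x * dg k.+1 x.
  rewrite (_ : pseries _ _ = pseries (pseries_diffs (c k.+1)) x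
    + (fun n => x * series (fun i => i%:R * c k.+1 i * x ^+ i.-1) n)).
    apply: cvgD; first exact: Cd.
    by apply: cvgM; [exact: cvg_cst|exact: E].
  apply/funext => n; rewrite !fctE /pseries /series /=.
  rewrite mulr_sumr -big_split /=; apply: eq_bigr => i _.
  rewrite c_diffs; case: i => [|i] /=; first by rewrite !mul0r mulr0 subr0 addr0.
  by rewrite exprS; move: (c k i.+1) (c k.+1 i.+1) (i.+1%:R : R) (x ^+ i) => *; ring.
by rewrite mulrDl mul1r; apply/esym/cvg_lim.
Qed.

Lemma g0 k : g k.+1 0 = 0.
Proof.
apply: cvg_lim => //; rewrite (_ : pseries _ _ = (fun=> 0)); first exact: cvg_cst.
apply/funext => n; rewrite /pseries /series /= big1// => -[|i] _.
  by rewrite /c /= rmorph0 !mul0r.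
by rewrite expr0n mulr0.
Qed.

Lemma g_0 (x : R) : pseries (c 0) x @ \oo --> (1 : R).
Proof.
rewrite -cvg_shiftS /= (_ : (fun _ => _) = (fun=> 1)); first exact: cvg_cst.
apply/funext => n; rewrite /pseries /series /= big_nat_recl// big1 => [|i _].
  by rewrite /c /= rmorph1 fact0 divr1 expr0 mulr1 addr0.
by rewrite /c stirling1_0 rmorph0 !mul0r.
Qed.

Lemma const_on (h : R -> R) :
  (forall y, `|y| < 1 -> is_derive y (1 : R) h 0) ->
  forall x, `|x| < 1 -> h x = h 0.
Proof.
move=> hd x; rewrite ltr_norml => /andP[x1 x2].
have key a b : a <= b -> -1 < a -> b < 1 -> h b = h a.
  move=> ab a1 b1.
  have H y : y \in `[a, b]%R -> is_derive y (1 : R) h 0.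
    rewrite in_itv /= => /andP[ay yb]; apply: hd.
    by rewrite ltr_norml (lt_le_trans a1 ay) (le_lt_trans yb b1).
  have D y : y \in `]a, b[%R -> is_derive y (1 : R) h 0.
    by rewrite in_itv /= => /andP[/ltW u /ltW v]; apply: H; rewrite in_itv/= u v.
  have C : {within `[a, b], continuous h}.
    by apply: derivable_within_continuous => y /H [].
  have [e _] := @MVT_segment R h (fun=> 0) a b ab D C.
  by rewrite mul0r => /eqP; rewrite subr_eq0 => /eqP.
by have [x0|/ltW x0] := leP 0 x; [|apply/esym]; apply: key => //; lra.
Qed.

Lemma gE k (x : R) : `|x| < 1 -> g k x = ln (1 + x) ^+ k / k`!%:R.
Proof.
elim: k x => [|k IH] x x1.
  by rewrite expr0 fact0 divr1; apply: cvg_lim => //; apply: g_0.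
pose L (y : R) := ln (1 + y) ^+ k.+1 / k.+1`!%:R.
suff : g k.+1 x - L x = g k.+1 0 - L 0.
  rewrite g0 /L addr0 ln1 expr0n mul0r subrr => /eqP.
  by rewrite subr_eq0 => /eqP.
apply: (@const_on (fun y => g k.+1 y - L y)) => // {x1}x x1.
have x0 : 0 < 1 + x by move: x1; rewrite ltr_norml; lra.
have D1 := @g_derive k.+1 _ x1.
have D2 : is_derive x (1 : R) (fun y : R => ln (1 + y)) (1 + x)^-1.
  have D3 : is_derive x (1 : R) (fun y : R => 1 + y) 1.
    have -> : (fun y : R => 1 + y) = cst 1 + id by [].
    by rewrite -[1 in X in is_derive _ _ _ X]add0r; apply: is_deriveD.
  have D4 := is_derive1_ln x0.
  by have := @is_derive1_comp R (@ln R) (fun y => 1 + y) x _ _ D4 D3; rewrite mulr1.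
have D5 : is_derive x (1 : R) L ((1 + x)^-1 * (ln (1 + x) ^+ k / k`!%:R)).
  have -> : L = (k.+1`!%:R)^-1 *: ((fun y : R => ln (1 + y)) ^+ k.+1).
    by apply/funext => y; rewrite /L mulrC /= -[RHS]/(_ * _) fctE.
  have := is_deriveZ (k.+1`!%:R)^-1 (is_deriveX k.+1 D2).
  rewrite (_ : _ *: _ = (1 + x)^-1 * (ln (1 + x) ^+ k / k`!%:R)) //.
  rewrite /GRing.scale /= factS natrM.
  have := fact_gt0 k; rewrite -(ltr0n R) => /lt0r_neq0 n0.
  have k0 : k.+1%:R != 0 :> R by rewrite pnatr_eq0.
  move: (ln _ ^+ _) (k.+1%:R : R) k0 => u v v0.
  by field; rewrite v0 n0 gt_eqF.
have -> : (0 : R) = dg k.+1 x - (1 + x)^-1 * (ln (1 + x) ^+ k / k`!%:R).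
  by rewrite -IH// -dgE// mulKf ?gt_eqF// subrr.
exact: is_deriveB.
Qed.
End Gen.

Lemma is_stirling1_stirling1 (R : realType) : is_stirling1 R stirling1.
Proof.
move=> k t t1; rewrite -gE//; have := @cvg_c R k t t1.
rewrite (_ : pseries _ _ = fun m : nat =>
   \sum_(k <= n < m) ratr (stirling1 n k) * (t ^+ n / n`!%:R)) //.
apply/funext => m; rewrite /pseries /series /=.
have z i : (i < k)%N -> ratr (stirling1 i k) / i`!%:R * t ^+ i = 0.
  by move=> ik; rewrite stirling1_small// rmorph0 !mul0r.
have [km|mk] := leqP k m.
  rewrite [LHS](big_cat_nat (n := k))//=.
  rewrite big_nat big1 => [|i /andP[_]]; last exact: z.
  by rewrite add0r; apply: eq_bigr => i _; rewrite mulrAC -mulrA.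
rewrite [RHS](big_geq (ltnW mk)) big_nat big1 => [//|i /andP[_ im]].
exact: z (ltn_trans im mk).
Qed.

End Stirling1Existence.

(* Main.v *)
Require Import Defs.
From mathcomp Require Import all_boot all_order all_algebra.
From mathcomp Require Import all_classical all_reals all_analysis.
From mathcomp Require Import ring lra zify.

Set Implicit Arguments.
Unset Strict Implicit.
Unset Printing Implicit Defensive.

Import Order.TTheory GRing.Theory Num.Theory.
Import numFieldNormedType.Exports.

Local Open Scope classical_set_scope.
Local Open Scope ring_scope.

(** Let [c_m] be the coefficients of [(- ln (1 - u)) ^ (p - 1) / (p - 1)!], so
    that [s (m, p - 1) = (-1) ^ (m + p - 1) * m! * c_m], and let
    [G n = \int_0^1 u ^ (n - 1) * (- ln (1 - u)) ^ (p - 1) / (p - 1)! du], which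
    is the sum of [c_m / (n + m)] over [m >= 1].  Then [G 0] is [zeta p] and
    [G (n + 1)] is, up to sign and [n!], the generalized Stirling number [S_n^p].
    Hence [zeta p] minus the first sum of the approximation is a truncation of
    the sum of [(- N) ^ n / n! * G n], that is, of the sum over [m >= 1] of
    [c_m * \int_0^1 u ^ (m - 1) * exp (- N u) du].  The second sum is obtained
    by integrating up to infinity instead of [1] (which gives
    [(m - 1)! / N ^ m]) and keeping only [m < N].  The tails beyond [1] for
    [m < N] cost at most [exp (- N)] each; for [m >= N] the integrals are at most
    [(N + 1) * exp (- N) / m], and the sum of [c_m / m] is [zeta p]; truncating
    the exponential series at [4 N + 1] costs a tail below [exp (- N)] because
    [exp 5 <= 4 ^ 4].  No integral is used: they are all replaced by their
    series and the recurrences given by integration by parts. *)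

(** * Power series coefficients of the powers of [- ln (1 - u)] *)

Section LogPowerCoefficients.
Variable R : realType.

(** [logpow_coef k m] is the coefficient of [u ^ m] in
    [(- ln (1 - u)) ^ k / k!]; the recurrence expresses that
    [(1 - u) d/du] lowers [k] by one. *)
Fixpoint logpow_coef (k m : nat) : R :=
  match k, m with
  | 0, 0 => 1
  | 0, _.+1 => 0
  | _.+1, 0 => 0
  | j.+1, n.+1 => (n%:R * logpow_coef j.+1 n + logpow_coef j n) / n.+1%:R
  end.

Lemma logpow_coefS k m :
  m.+1%:R * logpow_coef k.+1 m.+1 = m%:R * logpow_coef k.+1 m + logpow_coef k m.
Proof. by rewrite /= mulrC divfK// pnatr_eq0. Qed.

Lemma logpow_coef_ge0 k m : 0 <= logpow_coef k m.
Proof.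
elim: m k => [|m IH] [|k] //=.
by rewrite divr_ge0// addr_ge0// mulr_ge0.
Qed.

Lemma logpow_coef_le1 k m : logpow_coef k m <= 1.
Proof.
elim: m k => [|m IH] [|k] //; rewrite /= ler_pdivrMr ?ltr0Sn// mul1r.
by rewrite -natr1 lerD// ler_piMr.
Qed.

(** Dividing by [1 - u] sums the coefficients and integrating divides by the index. In this form
    Cesaro's theorem carries convergence to 0 from [k] to [k.+1]. *)
Lemma logpow_coef_mean k m :
  logpow_coef k.+1 m.+1 = arithmetic_mean (logpow_coef k) m.
Proof.
rewrite /arithmetic_mean /=.
have <- : m.+1%:R * logpow_coef k.+1 m.+1 = series (logpow_coef k) m.+1.
  elim: m => [|m IH]; first by rewrite logpow_coefS seriesSr /series /= big_nil mul0r.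
  by rewrite logpow_coefS IH [RHS]seriesSr.
by rewrite mulKf// pnatr_eq0.
Qed.

Lemma cvg_logpow_coef k : logpow_coef k @ \oo --> 0.
Proof.
elim: k => [|k IH]; rewrite -cvg_shiftS /=; first exact: cvg_cst.
under eq_fun do rewrite -/(logpow_coef k.+1 _.+1) logpow_coef_mean.
exact: cesaro.
Qed.

(** Once the sign and the factorial are stripped, the recurrence of [stirling1] becomes
    [logpow_coefS]. *)
Lemma stirling1_logpow_coef m k :
  ratr (Stirling1Existence.stirling1 m k)
    = (-1) ^+ (m + k) * m`!%:R * logpow_coef k m :> R.
Proof.
elim: m k => [|m IH] [|k].
- by rewrite /= rmorph1 expr0 !mulr1.
- by rewrite /= rmorph0 mulr0.
- by rewrite Stirling1Existence.stirling1_0 rmorph0 /= mulr0.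
transitivity ((-1) ^+ (m + k) * m`!%:R * (m.+1%:R * logpow_coef k.+1 m.+1));
  last by rewrite addSn addnS !exprS factS natrM; ring.
by rewrite logpow_coefS /= rmorphB rmorphM/= ratr_nat !IH addnS exprS; ring.
Qed.

End LogPowerCoefficients.
Arguments logpow_coef {R} k m.

(** * Euler beta integrals at natural arguments *)

Section Beta.
Variable R : realType.

(** The Euler integral [B(m + 1, i + 1)] of [u ^ m * (1 - u) ^ i]. *)
Definition beta_nat (m i : nat) : R := m`!%:R * i`!%:R / (m + i).+1`!%:R.

Let fact_neq0 n : n`!%:R != 0 :> R.
Proof. by rewrite pnatr_eq0 -lt0n fact_gt0. Qed.

Lemma beta_nat_ge0 m i : 0 <= beta_nat m i.
Proof. by rewrite divr_ge0// mulr_ge0. Qed.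

Lemma beta_nat0 m : beta_nat m 0 = m.+1%:R^-1.
Proof.
rewrite /beta_nat addn0 fact0 mulr1 factS natrM.
have := fact_neq0 m; have : m.+1%:R != 0 :> R by rewrite pnatr_eq0.
by move: (m.+1%:R) (m`!%:R) => x y x0 y0; field; rewrite x0 y0.
Qed.

Lemma beta_natSl m i :
  (m + i).+2%:R * beta_nat m.+1 i = m.+1%:R * beta_nat m i.
Proof.
have cancel_frac (x y a b c : R) : x != 0 -> y != 0 ->
  x * (a * b * c / (x * y)) = a * (b * c / y) by move=> x0 y0; field; rewrite x0 y0.
rewrite /beta_nat addSn (factS m) (factS (m + i).+1) (natrM _ m.+1)
  (natrM _ (m + i).+2).
by apply: cancel_frac; rewrite ?fact_neq0 ?pnatr_eq0.
Qed.

Lemma beta_natC m i : beta_nat m i = beta_nat i m.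
Proof. by rewrite /beta_nat addnC (mulrC m`!%:R). Qed.

(** The integrand is multiplied by [1 = (1 - u) + u]. *)
Lemma beta_nat_split m i : beta_nat m i = beta_nat m i.+1 + beta_nat m.+1 i.
Proof.
have x0 : (m + i).+2%:R != 0 :> R by rewrite pnatr_eq0.
apply: (mulfI x0); rewrite mulrDr beta_natSl (beta_natC m i.+1).
rewrite [in X in _ = X + _](addnC m) beta_natSl (beta_natC i).
by rewrite -mulrDl -natrD addSn addnS addnC.
Qed.

(** The difference on the right is [beta_nat m i.+1], so this is an integration by parts. *)
Lemma beta_natSl_ratio m i :
  i.+1%:R * beta_nat m.+1 i = m.+1%:R * (beta_nat m i - beta_nat m.+1 i).
Proof.
rewrite mulrBr -beta_natSl -mulrBl; congr (_ * _).
by rewrite (_ : (m + i).+2 = i.+1 + m.+1)%N ?natrD ?addrK// addSn addnS addnC.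
Qed.

Lemma beta_nat_le m i : beta_nat m i <= i.+1%:R^-1.
Proof.
elim: m => [|m IH]; first by rewrite beta_natC beta_nat0.
by apply: le_trans IH; rewrite (beta_nat_split m) lerDr beta_nat_ge0.
Qed.

(** Binomial expansion of [u ^ n = (1 - (1 - u)) ^ n] under the integral; the induction combines
    Pascal's rule with [beta_nat_split]. *)
Lemma beta_nat_sum m n i :
  \sum_(0 <= j < n.+1) (-1) ^+ j * 'C(n, j)%:R * beta_nat m (i + j)
    = beta_nat (m + n) i.
Proof.
elim: n i => [|n IH] i; first by rewrite big_nat1 bin0 !mul1r !addn0.
transitivity (beta_nat (m + n) i - beta_nat (m + n) i.+1); last first.
  by rewrite (beta_nat_split (m + n)) addnS; ring.
have <- : \sum_(0 <= j < n.+2) (-1) ^+ j * 'C(n, j)%:R * beta_nat m (i + j)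
    = beta_nat (m + n) i.
  by rewrite big_nat_recr//= bin_small// mulr0 mul0r addr0 IH.
rewrite -IH !(big_nat_recl n.+1)//= !bin0 -addrA -sumrB; congr (_ + _).
apply: eq_bigr => j _.
by rewrite binS natrD exprS addnS addSn; ring.
Qed.
End Beta.
Arguments beta_nat {R} m i.

(** * Series in these coefficients: finite binomial sums and zeta values *)

Section CoefficientSums.
Variable R : realType.
Local Notation c := (@logpow_coef R).
Local Notation b := (@beta_nat R).

(** In the limit this is
    [\int_0^1 (- ln (1 - u)) ^ k / k! * (1 - u) ^ i du = (i + 1) ^- (k + 1)],
    one integration by parts for each power of the logarithm. *)
Lemma series_logpow_coef_beta k i M :
  i.+1%:R * series (fun m => c k.+1 m * b m i) M.+1
    = series (fun m => c k m * b m i) M.+1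
      - M.+1%:R * c k.+1 M.+1 * b M i.
Proof.
elim: M => [|M IH].
  by rewrite logpow_coefS !seriesSr /series /= !big_nil !mul0r !add0r mulr0 subrr.
rewrite [in LHS]seriesSr mulrDr IH [in RHS](seriesSr _ M.+1) (logpow_coefS _ _ M.+1)
  [i.+1%:R * (_ * beta_nat M.+1 i)]mulrCA beta_natSl_ratio; ring.
Qed.

Lemma cvg_series_logpow_coef_beta k i :
  series (fun m => c k m * b m i) @ \oo --> ((i.+1%:R ^+ k.+1)^-1 : R).
Proof.
elim: k => [|k IH]; rewrite -cvg_shiftS /=.
  rewrite (_ : (fun _ => _) = cst (i.+1%:R ^+ 1)^-1 :> R^nat); first exact: cvg_cst.
  apply/funext => n; rewrite /series /= big_nat_recl// big1 => [|m _].
    by rewrite addr0 mul1r beta_natC beta_nat0.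
  by rewrite mul0r.
rewrite (_ : (fun _ => _) = ((fun M => i.+1%:R^-1 *
   (series (fun m => c k m * b m i) M.+1
      - c k.+1 M.+1 * (M.+1%:R * b M i))) : R^nat)); last first.
  apply/funext => M; apply: (mulfI (_ : i.+1%:R != 0 :> R)); first by rewrite pnatr_eq0.
  rewrite mulVKf ?pnatr_eq0// series_logpow_coef_beta; ring.
rewrite exprS invfM -[X in _ * X]subr0; apply: cvgM; first exact: cvg_cst.
  apply: cvgB.
  by rewrite cvg_shiftS.
(* The boundary term vanishes: by symmetry [beta_nat_le] gives [M.+1%:R * b M i <= 1]. *)
apply: (@squeeze_cvgr _ _ _ _ (cst 0) (fun M => c k.+1 M.+1)).
- apply: nearW => M; rewrite mulr_ge0 ?logpow_coef_ge0 ?mulr_ge0 ?beta_nat_ge0//.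
  rewrite ler_piMr ?logpow_coef_ge0// beta_natC -ler_pdivlMl// mulr1.
  exact: beta_nat_le.
- exact: cvg_cst.
- by rewrite cvg_shiftS; exact: cvg_logpow_coef.
Qed.

(** The factor [(n + m).+1%:R^-1] is [b (m + n) 0], which [beta_nat_sum] expands into the [b m j],
    whose series are known. *)
Lemma cvg_series_logpow_coef_harmonic k n :
  series (fun m => c k m / (n + m).+1%:R) @ \oo -->
  (  \sum_(0 <= j < n.+1) (-1) ^+ j * 'C(n, j)%:R / j.+1%:R ^+ k.+1 : R).
Proof.
rewrite (_ : series _ = fun M => \sum_(0 <= j < n.+1) (-1) ^+ j * 'C(n, j)%:R *
    series (fun m => c k m * b m j) M).
  apply: (cvg_big add_continuous) => j _; apply: cvgM; first exact: cvg_cst.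
  exact: cvg_series_logpow_coef_beta.
apply/funext => M; rewrite /series /=.
under [RHS]eq_bigr do rewrite mulr_sumr.
rewrite exchange_big/=; apply: eq_bigr => m _.
rewrite addnC -beta_nat0 -beta_nat_sum mulr_sumr.
by apply: eq_bigr => j _; rewrite add0n mulrCA.
Qed.

(** Iterates [beta_nat_split] from [b m 0 = m.+1%:R^-1]: a finite geometric expansion in powers of
    [1 - u], whose remainder is the last sum. *)
Lemma logpow_coef_sum_split k I M :
  series (fun m => c k m.+1 / m.+1%:R) M =
  \sum_(0 <= i < I) \sum_(0 <= m < M) c k m.+1 * b m.+1 i
    + \sum_(0 <= m < M) c k m.+1 * b m I.
Proof.
rewrite exchange_big -big_split; apply: eq_bigr => m _ /=.
rewrite -mulr_sumr -mulrDr; congr (_ * _).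
elim: I => [|I IH]; first by rewrite big_nil add0r beta_nat0.
by rewrite IH big_nat_recr//= (beta_nat_split _ m) addrA addrAC.
Qed.
Lemma nondecreasing_series_ge0 (u : R^nat) :
  (forall n, 0 <= u n) -> nondecreasing_seq (series u).
Proof. by move=> u0; apply: nondecreasing_series => n _ _. Qed.

Lemma series_ge0_le_limit (u : R^nat) (l : R) n :
  (forall n, 0 <= u n) -> series u @ \oo --> l -> series u n <= l.
Proof.
move=> u0 ul; rewrite -(cvg_lim _ ul)//.
by apply: nondecreasing_cvgn_le; [exact: nondecreasing_series_ge0|exact: cvgP ul].
Qed.

Lemma cvg_zeta p : (2 <= p)%N ->
  series (fun n : nat => (n.+1%:R ^+ p)^-1 : R) @ \oo --> zeta R p.
Proof.
move=> p2.
have S_nd : nondecreasing_seq (series (fun n : nat => (n.+1%:R ^+ p)^-1 : R)).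
  by apply: nondecreasing_series_ge0 => n; rewrite invr_ge0 exprn_ge0.
apply: nondecreasing_is_cvgn => //; exists 2 => _ [n _ <-].
(* Telescoping comparison with [1 / (n (n + 1))], available since [2 <= p]. *)
suff S2 : series (fun n => (n.+1%:R ^+ p)^-1 : R) n.+1 <= 2 - n.+1%:R^-1.
  by apply: le_trans (S_nd _ _ (leqnSn n)) (le_trans S2 _); rewrite gerBl invr_ge0.
elim: n => [|n IH].
  by rewrite /series /= big_nat1 expr1n invr1; lra.
rewrite seriesSr; apply: le_trans (lerD IH (_ : _ <= n.+1%:R^-1 - n.+2%:R^-1)) _;
  last by rewrite addrA subrK.
have n1 : 0 < n.+1%:R :> R by rewrite ltr0Sn.
have n2 : 0 < n.+2%:R :> R by rewrite ltr0Sn.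
apply: (@le_trans _ _ ((n.+2%:R ^+ 2)^-1)).
  by rewrite lef_pV2 ?posrE ?exprn_gt0// ler_weXn2l// ler1n.
apply: (@le_trans _ _ ((n.+1%:R * n.+2%:R)^-1)).
  by rewrite lef_pV2 ?posrE ?exprn_gt0 ?mulr_gt0// expr2 ler_pM2r// ler_nat.
have -> : n.+2%:R = n.+1%:R + 1 :> R by rewrite -natr1.
rewrite le_eqVlt; apply/orP; left; apply/eqP.
field; rewrite gt_eqF//= natr1 gt_eqF//.
Qed.

(** Each row [i] of the splitting is at most its full sum [(i + 1) ^- (k + 2)]. With [M] fixed, [I]
    is taken so large that the remainder, at most [M / (I + 1)], is below [e]. *)
Lemma logpow_coef_sum_le_zeta k M :
  series (fun m => c k.+1 m.+1 / m.+1%:R) M <= zeta R k.+2.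
Proof.
apply/ler_addgt0Pr => e e0; have [I MI] : exists I : nat, M%:R / I.+1%:R <= e.
  exists (Num.bound (M%:R / e)).
  rewrite ler_pdivrMr ?ltr0Sn// mulrC -ler_pdivrMr//.
  apply: ltW; apply: lt_trans (archi_boundP _) _; last by rewrite ltr_nat.
  by rewrite divr_ge0// ltW.
rewrite (logpow_coef_sum_split k.+1 I M) lerD//.
  apply: (@le_trans _ _ (series (fun n => (n.+1%:R ^+ k.+2)^-1) I)).
    apply: ler_sum => i _.
    have := @series_ge0_le_limit _ _ M.+1 _ (@cvg_series_logpow_coef_beta k.+1 i).
    rewrite /series /= big_nat_recl//= mul0r add0r; apply => n.
    by rewrite mulr_ge0 ?logpow_coef_ge0 ?beta_nat_ge0.
  apply: series_ge0_le_limit; last exact: cvg_zeta.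
  by move=> n; rewrite invr_ge0 exprn_ge0.
apply: le_trans MI; rewrite mulr_natl -[X in _ *+ X]subn0 -sumr_const_nat.
apply: ler_sum => m _; rewrite -[leRHS]mul1r.
by apply: ler_pM; rewrite ?logpow_coef_ge0 ?beta_nat_ge0 ?logpow_coef_le1 ?beta_nat_le.
Qed.

Lemma cvg_series_logpow_coef_zeta k :
  series (fun m => c k.+1 m / m%:R) @ \oo --> zeta R k.+2.
Proof.
pose z := series (fun m => c k.+1 m.+1 / m.+1%:R).
have term_ge0 m : 0 <= c k.+1 m.+1 / m.+1%:R.
  by rewrite divr_ge0// logpow_coef_ge0.
rewrite -cvg_shiftS (_ : (fun _ => _) = z); last first.
  apply/funext => n; rewrite /z /series /= big_nat_recl//=.
  by rewrite mul0r add0r.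
have cz : cvgn z.
  apply: nondecreasing_is_cvgn; first exact: nondecreasing_series_ge0.
  by exists (zeta R k.+2) => _ [n _ <-]; exact: logpow_coef_sum_le_zeta.
suff <- : limn z = zeta R k.+2 by [].
apply/eqP; rewrite eq_le; apply/andP; split.
  by apply: limr_le => //; apply: nearW => n; exact: logpow_coef_sum_le_zeta.
(* Reverse inequality: with [I] fixed, the nonnegative remainder of the splitting is dropped and [M]
   tends to infinity. *)
apply: limr_le; first exact: cvgP (cvg_zeta _).
apply: nearW => I.
have cI : (fun M => \sum_(0 <= i < I) series (fun m => c k.+1 m * b m i) M.+1)
    @ \oo --> series (fun n => (n.+1%:R ^+ k.+2)^-1 : R) I.
  apply: (cvg_big add_continuous) => i _.
  by rewrite cvg_shiftS; exact: cvg_series_logpow_coef_beta.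
apply: (ler_cvg_to cI cz); apply: nearW => M.
rewrite /z (logpow_coef_sum_split k.+1 I M).
rewrite -[leLHS]addr0; apply: lerD.
  by apply: ler_sum => i _; rewrite /series /= big_nat_recl//= mul0r add0r.
by apply: sumr_ge0 => m _; rewrite mulr_ge0 ?logpow_coef_ge0 ?beta_nat_ge0.
Qed.

End CoefficientSums.

(** * Exponential integrals over the unit interval: recurrences and bounds *)

Section TruncatedGamma.
Variable R : realType.
Implicit Types x : R.

Definition gamma01_partial x m : R^nat :=
  series (fun n => exp_coeff (- x) n / (n + m).+1%:R).

(** [\int_0^1 u ^ m * exp (- x * u) du], by expanding the exponential. *)
Definition gamma01 x m : R := limn (gamma01_partial x m).

Lemma gamma01_partial_dist x m K L (B : R) : 0 <= x -> (K <= L)%N ->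
  \sum_(K <= n < L) exp_coeff x n <= B ->
  `|gamma01_partial x m L - gamma01_partial x m K| <= B / m.+1%:R.
Proof.
move=> x0 KL SB; rewrite /gamma01_partial /series /=.
rewrite (big_cat_nat _ KL)//= addrAC subrr add0r.
apply: le_trans (ler_norm_sum _ _ _) _.
apply: le_trans (ler_wpM2r _ SB); last by rewrite invr_ge0.
rewrite mulr_suml; apply: ler_sum => n _.
rewrite !normrM !normfV !normr_nat normrX normrN (ger0_norm x0).
by rewrite ler_wpM2l ?divr_ge0 ?exprn_ge0// lef_pV2 ?posrE// ler_nat ltnS leq_addl.
Qed.

Lemma series_exp_coeff_le x n : 0 <= x -> series (exp_coeff x) n <= expR x.
Proof.
move=> x0; apply: series_ge0_le_limit; last exact: is_cvg_series_exp_coeff.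
by move=> k; exact: exp_coeff_ge0.
Qed.

Lemma cvg_gamma01 x m : 0 <= x -> gamma01_partial x m @ \oo --> gamma01 x m.
Proof.
move=> x0; apply: normed_cvg.
apply: series_le_cvg (is_cvg_series_exp_coeff x) => n /=.
- exact: normr_ge0.
- exact: exp_coeff_ge0.
- rewrite !normrM !normfV !normr_nat normrX normrN (ger0_norm x0).
  by rewrite ler_piMr ?divr_ge0 ?exprn_ge0// invf_le1// ler1n.
Qed.

Lemma gamma01_dist x m K (B : R) : 0 <= x ->
  (forall L, \sum_(K <= n < L) exp_coeff x n <= B) ->
  `|gamma01 x m - gamma01_partial x m K| <= B / m.+1%:R.
Proof.
move=> x0 SB.
have cd : (fun L => `|gamma01_partial x m L - gamma01_partial x m K|) @ \oo
    --> `|gamma01 x m - gamma01_partial x m K|.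
  by apply: cvg_norm; apply: cvgB; [exact: cvg_gamma01|exact: cvg_cst].
apply: (cvgr_to_le cd); exists K => // L /= KL.
exact: gamma01_partial_dist.
Qed.

Lemma gamma01_norm_le x m : 0 <= x -> m.+1%:R * `|gamma01 x m| <= expR x.
Proof.
move=> x0; have := @gamma01_dist x m 0 (expR x) x0 (fun L => series_exp_coeff_le L x0).
by rewrite /gamma01_partial /series /= big_nil subr0 ler_pdivlMr// mulrC.
Qed.

Lemma exp_coeffS x n : exp_coeff x n.+1 = x / n.+1%:R * exp_coeff x n.
Proof. by rewrite /exp_coeff /= exprS factS natrM invfM mulrACA. Qed.

Lemma gamma01_partial0 x K :
  x * gamma01_partial x 0 K = 1 - series (exp_coeff (- x)) K.+1.
Proof.
rewrite /gamma01_partial; elim: K => [|K IH].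
  rewrite /series /= big_nil big_nat1 /exp_coeff /= expr0 fact0; lra.
rewrite seriesSr mulrDr IH [in RHS]seriesSr exp_coeffS addn0.
move: (exp_coeff _ _) => u; ring.
Qed.

(** Integration by parts on partial sums; the extra term on the right balances the factor [x] on the
    left. *)
Lemma gamma01_partialS x m K :
  x * gamma01_partial x m.+1 K =
    m.+1%:R * gamma01_partial x m K.+1 - series (exp_coeff (- x)) K.+1.
Proof.
rewrite /gamma01_partial; elim: K => [|K IH].
  rewrite /series /= !big_nat1 big_nil /exp_coeff /= expr0 fact0 add0n.
  by rewrite mulr0 divr1 div1r divff ?pnatr_eq0// subrr.
rewrite seriesSr mulrDr IH [in RHS](seriesSr _ K.+1) [in RHS](seriesSr _ K.+1).
rewrite exp_coeffS addnS addSn.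
have -> : m.+1%:R = (K + m).+2%:R - K.+1%:R :> R.
  by rewrite (_ : (K + m).+2 = m.+1 + K.+1)%N ?natrD ?addrK// addSn addnS addnC.
have : K.+1%:R != 0 :> R by rewrite pnatr_eq0.
have : (K + m).+2%:R != 0 :> R by rewrite pnatr_eq0.
move: (exp_coeff _ _) (series _ _) (series _ _) (K.+1%:R) ((K + m).+2%:R).
by move=> u v w k d d0 k0; field; rewrite k0.
Qed.

Lemma gamma01_0 x : 0 <= x -> x * gamma01 x 0 = 1 - expR (- x).
Proof.
move=> x0; have c1 : (fun K => x * gamma01_partial x 0 K) @ \oo --> x * gamma01 x 0.
  by apply: cvgM; [exact: cvg_cst|exact: cvg_gamma01].
have : (fun K => 1 - series (exp_coeff (- x)) K.+1) @ \oo --> 1 - expR (- x).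
  apply: cvgB; first exact: cvg_cst.
  by rewrite cvg_shiftS; exact: is_cvg_series_exp_coeff.
under eq_fun do rewrite -gamma01_partial0.
by move=> c2; rewrite -(cvg_lim _ c1)// -(cvg_lim _ c2).
Qed.

Lemma gamma01S x m : 0 <= x ->
  x * gamma01 x m.+1 = m.+1%:R * gamma01 x m - expR (- x).
Proof.
move=> x0; have c1 : (fun K => x * gamma01_partial x m.+1 K) @ \oo --> x * gamma01 x m.+1.
  by apply: cvgM; [exact: cvg_cst|exact: cvg_gamma01].
have : (fun K => m.+1%:R * gamma01_partial x m K.+1
    - series (exp_coeff (- x)) K.+1) @ \oo --> m.+1%:R * gamma01 x m - expR (- x).
  apply: cvgB; last by rewrite cvg_shiftS; exact: is_cvg_series_exp_coeff.
  by apply: cvgM; [exact: cvg_cst|rewrite cvg_shiftS; exact: cvg_gamma01].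
under eq_fun do rewrite -gamma01_partialS.
by move=> c2; rewrite -(cvg_lim _ c1)// -(cvg_lim _ c2).
Qed.

(** By [gamma01S] the differences satisfy [N * E (m + 1) = (m + 1) * E m - exp (- N)], so the bound
    propagates as long as [m + 2 <= N]. *)
Lemma gamma01_complement N m : (m < N)%N ->
  `|gamma01 N%:R m - m`!%:R / N%:R ^+ m.+1| <= expR (- N%:R).
Proof.
move=> mN; have N0 : 0 < N%:R :> R by rewrite ltr0n (leq_trans _ mN).
have e0 := expR_ge0 (- N%:R : R).
elim: m mN => [|m IH] mN.
  rewrite -(ler_pM2l N0) -{1}(gtr0_norm N0) -normrM mulrBr gamma01_0 ?(ltW N0)//.
  rewrite fact0 expr1 div1r divff ?gt_eqF// addrAC subrr add0r normrN.
  by rewrite ger0_norm// ler_peMl// ler1n.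
rewrite -(ler_pM2l N0) -{1}(gtr0_norm N0) -normrM mulrBr gamma01S ?(ltW N0)//.
have -> : N%:R * (m.+1`!%:R / N%:R ^+ m.+2) =
    m.+1%:R * (m`!%:R / N%:R ^+ m.+1) :> R.
  rewrite factS natrM (exprS _ m.+1) invfM.
  by rewrite mulrCA mulVKf ?gt_eqF// -mulrA.
rewrite addrAC -mulrBr; apply: le_trans (ler_normB _ _) _.
rewrite normrM normr_nat (ger0_norm e0).
apply: (@le_trans _ _ (m.+1%:R * expR (- N%:R) + expR (- N%:R))).
  by rewrite lerD2r ler_wpM2l// IH// ltnW.
by rewrite -[X in _ + X]mul1r -mulrDl ler_wpM2r// natr1 ler_nat.
Qed.

(** The recurrence [gamma01S] is read from [m + 1] down to [m]. As [N <= q * (m + 2)], each use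
    contracts by [q]: the crude bound [exp N] dies out and the fixed point of
    [B = exp (- N) + q * B] remains. *)
Lemma gamma01_large N m : (N <= m.+1)%N ->
  m.+1%:R * `|gamma01 N%:R m| <= N.+1%:R * expR (- N%:R) :> R.
Proof.
move=> Nm; have e0 := expR_ge0 (- N%:R : R).
pose q : R := N%:R / N.+1%:R.
have q0 : 0 <= q by rewrite divr_ge0.
have q1 : q < 1 by rewrite ltr_pdivrMr ?ltr0Sn// mul1r ltr_nat.
have key j : m.+1%:R * `|gamma01 N%:R m|
    <= N.+1%:R * expR (- N%:R) + expR N%:R * q ^+ j :> R.
  elim: j m Nm => [|j IH] m Nm.
    rewrite mulr1; apply: le_trans (gamma01_norm_le _ _) _ => //.
    by rewrite lerDr mulr_ge0.
  have -> : m.+1%:R * `|gamma01 N%:R m|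
      = `|expR (- N%:R) + N%:R * gamma01 N%:R m.+1| :> R.
    by rewrite gamma01S// addrC subrK normrM normr_nat.
  apply: le_trans (ler_normD _ _) _; rewrite (ger0_norm e0) normrM normr_nat.
  have : N%:R * `|gamma01 N%:R m.+1| <= q * (m.+2%:R * `|gamma01 N%:R m.+1|) :> R.
    rewrite mulrA ler_wpM2r// /q mulrAC ler_pdivlMr ?ltr0Sn// ler_wpM2l//.
    by rewrite ler_nat ltnS.
  move=> /(le_trans) /(_ (ler_wpM2l q0 (IH m.+1 (leqW Nm)))) /(lerD (lexx _)) h.
  apply: le_trans (h _) _; rewrite exprS mulrDr [q * (N.+1%:R * _)]mulrA.
  rewrite {1}/q divfK ?pnatr_eq0// addrA -natr1 mulrDl mul1r.
  by rewrite (addrC (expR _)) mulrCA.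
have cq : (fun j => N.+1%:R * expR (- N%:R) + expR N%:R * q ^+ j : R) @ \oo
    --> N.+1%:R * expR (- N%:R) + expR N%:R * 0.
  apply: cvgD; first exact: cvg_cst.
  by apply: cvgM; [exact: cvg_cst|apply: cvg_expr; rewrite ger0_norm].
rewrite -[leRHS]addr0 -(mulr0 (expR N%:R)).
by apply: (cvgr_to_ge cq); apply: nearW.
Qed.

Lemma expR_le_256 : expR 5 <= 256 :> R.
Proof.
(* The value [6 / 5] is the inverse of [1 - 1 / 6]; then [(6 / 5) ^ 6 <= 3] and [3 ^ 5 = 243]. *)
have e6 : expR (6^-1) <= 6 / 5 :> R.
  have := expR_ge1Dx (- 6^-1 : R).
  rewrite expRN -[leRHS]mul1r ler_pdivlMr ?expR_gt0//; lra.
have -> : expR 5 = (expR (6^-1) ^+ 6) ^+ 5 :> R.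
  by rewrite -!expRM_natl; congr expR; lra.
have h : expR (6^-1) ^+ 6 <= 3 :> R.
  apply: le_trans (lerXn2r 6 _ _ e6) _; rewrite ?nnegrE ?expR_ge0 //; lra.
apply: le_trans (lerXn2r 5 _ _ h) _; rewrite ?nnegrE ?exprn_ge0 ?expR_ge0//; lra.
Qed.

(** Replacing [N] by [4 N] multiplies each term of the tail by at least [4 ^ (4 N)], so the tail is
    at most [exp (4 N) / 256 ^ N]. *)
Lemma exp_coeff_tail N L :
  \sum_((4 * N).+2 <= n < L) exp_coeff N%:R n <= expR (- N%:R) :> R.
Proof.
have fourN n : exp_coeff (4 * N%:R : R) n = 4 ^+ n * exp_coeff N%:R n.
  by rewrite /exp_coeff /= exprMn mulrA.
have N4 : 0 <= 4 * N%:R :> R by rewrite mulr_ge0.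
have [LK|/ltnW KL] := leqP L (4 * N).+2; first by rewrite big_geq ?expR_ge0.
rewrite -(ler_pM2l (exprn_gt0 (4 * N) (ltr0Sn R 3))).
apply: (@le_trans _ _ (expR (4 * N%:R))).
  apply: le_trans _ (series_exp_coeff_le L N4).
  rewrite /series /= [leRHS](big_cat_nat (n := (4 * N).+2) _ KL)//=.
  apply: ler_wpDl; first by apply: sumr_ge0 => n _; exact: exp_coeff_ge0.
  rewrite mulr_sumr; apply: ler_sum_nat => n /andP[Kn _].
  rewrite fourN ler_wpM2r ?exp_coeff_ge0// ler_weXn2l// ?ler1n//.
  by apply: leq_trans Kn; rewrite ltnW// ltnW.
rewrite expRN ler_pdivlMr ?expR_gt0// -expRD.
rewrite (_ : 4 * N%:R + N%:R = N%:R * 5); last by ring.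
rewrite expRM_natl exprM; apply: lerXn2r; rewrite ?nnegrE ?expR_ge0 ?exprn_ge0//.
apply: le_trans expR_le_256 _; lra.
Qed.

End TruncatedGamma.

(** * Uniqueness of power series coefficients *)

Section PowerSeriesUniqueness.
Variable R : realType.

Lemma geometric_sum_le2 (r : R) l : 0 <= r -> r <= 2^-1 ->
  \sum_(0 <= j < l) r ^+ j <= 2.
Proof.
move=> r0 r2; elim: l => [|l IH]; first by rewrite big_nil.
rewrite big_nat_recl//; under eq_bigr do rewrite exprS.
rewrite -mulr_sumr expr0.
have := ler_pM r0 (sumr_ge0 _ (fun i _ => exprn_ge0 i r0)) r2 IH.
by move=> h; apply: le_trans (lerD (lexx 1) h) _; lra.
Qed.

Lemma pseries_eq0_coef (d : R^nat) :
  (forall t : R, `|t| < 1 -> pseries d t @ \oo --> (0 : R)) ->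
  forall n, d n = 0.
Proof.
move=> d0.
have half1 : `|2^-1| < 1 :> R by rewrite ger0_norm; lra.
have [K [Kreal Kf]] := cvg_series_bounded (cvgP _ (d0 _ half1)).
pose M := `|K| + 1.
have M0 : 0 < M by rewrite ltr_wpDl.
have dM n : `|d n| * 2^-1 ^+ n <= M.
  have := Kf M; rewrite (le_lt_trans (ler_norm K)) ?ltrDl// => /(_ isT n I).
  by rewrite /= normrM normrX (@ger0_norm _ 2^-1)// invr_ge0.
elim/ltn_ind => n IH.
(* With the earlier coefficients zero, [d n * t ^ n] is balanced by the later terms, at most
   [M * (2 t) ^ (n + 1)] times a geometric sum of ratio [2 t <= 1 / 2]. *)
have dn_le t : 0 < t -> t <= 4^-1 -> `|d n| <= 4 * M * 2 ^+ n * t.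
  move=> t0 t4; have t1 : `|t| < 1 by rewrite gtr0_norm//; lra.
  have cd : (fun L => `|pseries d t L - d n * t ^+ n|) @ \oo
      --> `|0 - d n * t ^+ n|.
    by apply: cvg_norm; apply: cvgB; [exact: d0|exact: cvg_cst].
  rewrite sub0r normrN normrM normrX (gtr0_norm t0) in cd.
  rewrite -(ler_pM2r (exprn_gt0 n t0)).
  apply: (cvgr_to_le cd); exists n.+1 => // L /= nL.
  rewrite /pseries /series /= (big_cat_nat _ nL)//= big_nat_recr//=.
  rewrite big_nat big1 => [|i /andP[_ /IH ->]]; last by rewrite mul0r.
  rewrite add0r addrAC subrr add0r.
  apply: le_trans (ler_norm_sum _ _ _) _.
  rewrite -{1}(add0n n.+1) big_addn.
  apply: (@le_trans _ _ (\sum_(0 <= i < L - n.+1) M * (2 * t) ^+ n.+1 * (2 * t) ^+ i)).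
    apply: ler_sum => i _; rewrite -mulrA -exprD (addnC n.+1).
    move: (i + n.+1)%N => j.
    rewrite normrM normrX (gtr0_norm t0) exprMn mulrA ler_wpM2r ?exprn_ge0 ?(ltW t0)//.
    by rewrite -ler_pdivrMr ?exprn_gt0// -exprVn.
  rewrite -mulr_sumr.
  have r0 : 0 <= 2 * t by rewrite mulr_ge0// ltW.
  have := geometric_sum_le2 (L - n.+1) r0 _; rewrite (_ : 2 * t <= 2^-1); last lra.
  move=> /(_ isT) h.
  apply: le_trans (ler_wpM2l _ h) _; first by rewrite mulr_ge0 ?exprn_ge0// ltW.
  rewrite exprMn !exprS; move: (2 ^+ n) (t ^+ n) => a b.
  by rewrite le_eqVlt; apply/orP; left; apply/eqP; ring.
apply/eqP; rewrite -normr_le0 leNgt; apply/negP => dn0.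
pose C := 4 * M * 2 ^+ n.
have C0 : 0 < C by rewrite !mulr_gt0// exprn_gt0.
have E0 : 0 < 2 * C + 4 * `|d n| by rewrite addr_gt0// mulr_gt0.
(* This [t] is below [1 / 4] and makes [C * t] smaller than half of [|d n|], a contradiction. *)
have := dn_le (`|d n| / (2 * C + 4 * `|d n|)) (divr_gt0 dn0 E0).
rewrite ler_pdivrMr// -/C; have -> : `|d n| <= 4^-1 * (2 * C + 4 * `|d n|) by lra.
move=> /(_ isT).
rewrite mulrA ler_pdivlMr// => h.
have := mulr_gt0 dn0 dn0; have := mulr_gt0 dn0 C0; nra.
Qed.

(** Since [s] is known only through its generating functions, this is what identifies it with the
    recursive [stirling1]. *)
Lemma is_stirling1_unique (s1 s2 : nat -> nat -> rat) n k :
  is_stirling1 R s1 -> is_stirling1 R s2 -> (k <= n)%N -> s1 n k = s2 n k.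
Proof.
move=> h1 h2 kn.
pose d n : R := if (k <= n)%N then ratr (s1 n k - s2 n k) / n`!%:R else 0.
suff /(_ n) : forall n, d n = 0.
  rewrite /d kn => /eqP; rewrite mulf_eq0 invr_eq0 pnatr_eq0 eqn0Ngt fact_gt0 orbF.
  by rewrite fmorph_eq0 subr_eq0 => /eqP.
apply: pseries_eq0_coef => t t1.
pose f s m : R := \sum_(k <= n < m) (ratr (s n k) * (t ^+ n / n`!%:R)).
rewrite (_ : pseries d t = f s1 - f s2); last first.
  apply/funext => M.
  rewrite fctE /f /pseries /series /= -sumrB big_mkord [RHS]big_geq_mkord [RHS]big_mkcond/=.
  apply: eq_bigr => i _; rewrite /d; case: ifP => _; last by rewrite mul0r.
  by rewrite rmorphB/= -mulrBl mulrAC -mulrA.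
rewrite -(subrr (ln (1 + t) ^+ k / k`!%:R)).
by apply: cvgB; [exact: h1|exact: h2].
Qed.

End PowerSeriesUniqueness.

(** * Rewriting of the two sums and the error estimate *)

Section ZetaApproximation.
Variable R : realType.
Local Notation c := (@logpow_coef R).

Lemma logpow_coef_small k m : (m < k)%N -> c k m = 0.
Proof.
elim: m k => [|m IH] [|k] // mk.
by rewrite /= (IH k)// (IH k.+1 (ltnW mk)) mulr0 addr0 mul0r.
Qed.

Let stirling_moment p n : R :=
  \sum_(0 <= j < n.+1) (-1) ^+ j * 'C(n, j)%:R / j.+1%:R ^+ p.

(** The index is shifted by one so that [zeta R p] becomes the term of index 0 of the exponential
    sum. *)
Let moment p n : R := if n is n'.+1 then stirling_moment p n' else zeta R p.

Lemma cvg_moment k n :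
  series (fun m => c k.+1 m / (n + m)%:R) @ \oo --> moment k.+2 n.
Proof.
case: n => [|n]; first exact: cvg_series_logpow_coef_zeta.
exact: cvg_series_logpow_coef_harmonic.
Qed.

Lemma ratr_gen_stirling2 p n :
  ratr (gen_stirling2 p n) = (-1) ^+ n / n`!%:R * stirling_moment p n :> R.
Proof.
rewrite /gen_stirling2 rmorphM/= fmorph_div/= rmorphXn/= rmorphN1 ratr_nat.
rewrite rmorph_sum; congr (_ * _); apply: eq_bigr => j _ /=.
by rewrite fmorph_div/= rmorphM/= !rmorphXn/= rmorphN1 !ratr_nat.
Qed.

Lemma zeta_sub_gen_stirling2_sum p N L :
  zeta R p
    - ratr (\sum_(0 <= n < L) (gen_stirling2 p n / n.+1%:R * N%:R ^+ n.+1))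
  = \sum_(0 <= n < L.+1) exp_coeff (- N%:R) n * moment p n.
Proof.
rewrite big_nat_recl//= /exp_coeff/= expr0 fact0 divr1 mul1r rmorph_sum -sumrN.
congr (_ + _); apply: eq_bigr => n _ /=.
rewrite rmorphM/= rmorphM/= ratr_gen_stirling2 fmorphV/= rmorphXn/= !ratr_nat.
rewrite factS natrM invfM (exprNn N%:R) [(-1) ^+ n.+1]exprS.
move: (n.+1%:R^-1) (n`!%:R^-1) (stirling_moment _ _) (N%:R ^+ n.+1) => u v w x.
by ring.
Qed.

Lemma cvg_zeta_sub_gen_stirling2_sum k N L :
  (fun M => \sum_(0 <= m < M) c k.+1 m.+1 * gamma01_partial N%:R m L.+1) @ \oo
  --> zeta R k.+2
    - ratr (\sum_(0 <= n < L) (gen_stirling2 k.+2 n / n.+1%:R * N%:R ^+ n.+1)).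
Proof.
rewrite zeta_sub_gen_stirling2_sum.
(* The finite sums are exchanged; [M.+1] makes room for the term [m = 0], which is zero because
   [c k.+1 0 = 0]. *)
rewrite (_ : (fun _ => _) = fun M => \sum_(0 <= n < L.+1) exp_coeff (- N%:R) n *
   series (fun m => c k.+1 m / (n + m)%:R) M.+1); last first.
  apply/funext => M; rewrite /series /=.
  under [RHS]eq_bigr do rewrite mulr_sumr.
  rewrite exchange_big/= [RHS]big_nat_recl//= [X in _ = X + _]big1 => [|n _]; last by rewrite mul0r mulr0.
  rewrite add0r; apply: eq_bigr => m _.
  rewrite /gamma01_partial /series /= mulr_sumr; apply: eq_bigr => n _.
  by rewrite addnS mulrCA.
apply: (cvg_big add_continuous) => n _; apply: cvgM; first exact: cvg_cst.
by rewrite cvg_shiftS; exact: cvg_moment.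
Qed.

(** Reindexing by [m = n + k]; the right side can start at 0 because its terms with [m < k]
    vanish. *)
Lemma ratr_stirling1_sum (s : nat -> nat -> rat) k N : is_stirling1 R s ->
  (k.+2 <= N)%N ->
  ratr (\sum_(0 <= n < (N - k.+2).+1)
      ((-1) ^+ n * s (n + k.+2 - 1)%N (k.+2 - 1)%N
        / ((n + k.+2 - 1)%:R * N%:R ^+ (n + k.+2 - 1))))
  = \sum_(0 <= m < N.-1) c k.+1 m.+1 * (m`!%:R / N%:R ^+ m.+1).
Proof.
move=> hs kN; have kN1 : (k <= N.-1)%N by rewrite -ltnS prednK// ltnW// (leq_trans _ kN).
rewrite (big_cat_nat _ kN1)// [X in _ = X + _](_ : _ = 0); last first.
  rewrite big_nat big1 // => m /andP[_ mk].
  by rewrite logpow_coef_small// mul0r.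
rewrite add0r -[X in _ = \sum_(X <= _ < _) _]add0n big_addn rmorph_sum.
have -> : (N - k.+2).+1 = (N.-1 - k)%N by lia.
have sE m : (k < m)%N ->
    ratr (s m k.+1) = (-1) ^+ (m + k.+1) * m`!%:R * c k.+1 m.
  move=> km; rewrite -stirling1_logpow_coef; congr ratr.
  exact: is_stirling1_unique hs (@Stirling1Existence.is_stirling1_stirling1 R) km.
apply: eq_bigr => n _; rewrite !addnS !subn1 rmorphM rmorphM fmorphV rmorphM.
rewrite 2!rmorphXn rmorphN1 [in LHS]/= !ratr_nat sE ?ltnS ?leq_addl// factS natrM invfM.
rewrite (_ : (n + k).+1 + k.+1 = n + 2 * k.+1)%N; last by lia.
rewrite exprD (exprM _ 2) sqrrN expr1n expr1n mulr1.
have dd : (n + k).+1%:R * (n + k).+1%:R^-1 = 1 :> R by rewrite divff ?pnatr_eq0.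
have aa : (-1) ^+ n * (-1) ^+ n = 1 :> R by rewrite -expr2 sqrr_sign.
move: dd aa (c _ _) ((n + k)`!%:R : R) => + + u f.
move: ((n + k).+1%:R) ((n + k).+1%:R^-1) ((-1) ^+ n) => d d' a dd aa.
transitivity (a * a * (d * d') * (u * (f / N%:R ^+ (n + k).+1))).
  by move: (N%:R ^+ (n + k).+1)^-1 => x; ring.
by rewrite aa dd !mul1r.
Qed.

Lemma zeta_ge0 k : 0 <= zeta R k.+2.
Proof. by have := @logpow_coef_sum_le_zeta R k 0; rewrite /series /= big_nil. Qed.

(** With [e = exp (- N)], the indices below [N - 1] contribute at most [2 * e * N], the others at
    most [(N + 2) * e] times the zeta value, and [N + 2 <= 3 * N]. *)
Lemma truncation_error k N M : (0 < N)%N -> (N.-1 <= M)%N ->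
  `|\sum_(0 <= m < M) c k.+1 m.+1 * gamma01_partial N%:R m (4 * N).+2
    - \sum_(0 <= m < N.-1) c k.+1 m.+1 * (m`!%:R / N%:R ^+ m.+1)|
  <= (2 + 3 * zeta R k.+2) * N%:R * expR (- N%:R).
Proof.
move=> N0 NM; set e := expR (- N%:R).
pose G m : R := gamma01_partial N%:R m (4 * N).+2.
have e0 : 0 <= e := expR_ge0 _.
have trunc m : `|gamma01 N%:R m - G m| <= e / m.+1%:R.
  exact: gamma01_dist (fun L => exp_coeff_tail _ N L).
have small m : (m < N)%N -> `|G m - m`!%:R / N%:R ^+ m.+1| <= 2 * e.
  move=> mN; apply: le_trans (ler_distD (gamma01 N%:R m) _ _) _.
  rewrite distrC (_ : 2 * e = e + e); last by ring.
  apply: lerD (gamma01_complement R mN); apply: le_trans (trunc m) _.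
  by rewrite ler_piMr// invf_le1 ?ltr0Sn// ler1n.
have large m : (N <= m.+1)%N -> `|G m| <= (N%:R + 2) * e / m.+1%:R.
  move=> Nm; rewrite -[G m](subKr (gamma01 N%:R m)).
  apply: le_trans (ler_normB _ _) _.
  rewrite (_ : (N%:R + 2) * e = N.+1%:R * e + e); last by rewrite -natr1; ring.
  rewrite [leRHS]mulrDl lerD// ler_pdivlMr ?ltr0Sn// mulrC.
  exact: gamma01_large.
rewrite (big_cat_nat _ NM)//= addrAC -sumrB.
have bound1 : `|\sum_(0 <= m < N.-1) (c k.+1 m.+1 * G m
    - c k.+1 m.+1 * (m`!%:R / N%:R ^+ m.+1))| <= 2 * e * N%:R.
  apply: le_trans (ler_norm_sum _ _ _) _.
  apply: (@le_trans _ _ (\sum_(0 <= m < N.-1) 2 * e)); last first.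
    rewrite sumr_const_nat subn0 -[leLHS]mulr_natr ler_wpM2l ?mulr_ge0//.
    by rewrite ler_nat leq_pred.
  apply: ler_sum_nat => m /andP[_ mN].
  rewrite -mulrBr normrM (ger0_norm (logpow_coef_ge0 _ _ _)) -[leRHS]mul1r.
  apply: ler_pM; rewrite ?logpow_coef_ge0 ?logpow_coef_le1//.
  by apply: small; apply: leq_trans mN (leq_pred N).
have bound2 : `|\sum_(N.-1 <= m < M) c k.+1 m.+1 * G m|
    <= (N%:R + 2) * e * zeta R k.+2.
  apply: le_trans (ler_norm_sum _ _ _) _.
  apply: (@le_trans _ _ (\sum_(N.-1 <= m < M) (N%:R + 2) * e * (c k.+1 m.+1 / m.+1%:R))).
    apply: ler_sum_nat => m /andP[Nm _].
    rewrite normrM (ger0_norm (logpow_coef_ge0 _ _ _)).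
    rewrite [leRHS]mulrCA ler_wpM2l ?logpow_coef_ge0// large//.
    by rewrite -(prednK N0) ltnS.
  rewrite -mulr_sumr ler_wpM2l ?mulr_ge0 ?addr_ge0//.
  apply: le_trans _ (logpow_coef_sum_le_zeta R k M).
  rewrite /series /= [leRHS](big_cat_nat _ NM)//= ler_wpDl//.
  by apply: sumr_ge0 => m _; rewrite divr_ge0 ?(logpow_coef_ge0 _ k.+1 m.+1).
apply: le_trans (ler_normD _ _) (le_trans (lerD bound1 bound2) _).
have N1 : 1 <= N%:R :> R by rewrite ler1n.
have ez : 0 <= e * zeta R k.+2 by rewrite mulr_ge0 ?zeta_ge0.
have := ler_wpM2r ez N1; nra.
Qed.

End ZetaApproximation.

Theorem theorem7 (R : realType) (s : nat -> nat -> rat)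
    (hs : is_stirling1 R s) (p : nat) (hp : (2 <= p)%N) :
  exists C : R, 0 < C /\
    \forall N \near \oo,
      `|zeta R p - ratr (zeta_approx s p N)| <= C * N%:R * expR (- N%:R).
Proof.
case: p hp => [|[|k]] // _; exists (2 + 3 * zeta R k.+2); split.
  by rewrite ltr_wpDr// mulr_ge0 ?zeta_ge0.
exists k.+2 => // N /= kN; have N0 : (0 < N)%N by apply: leq_trans kN.
rewrite /zeta_approx rmorphD/= (ratr_stirling1_sum hs kN) opprD addrA.
set Y := \sum_(0 <= m < N.-1) _.
(* The [(4 * N).+2] terms are the [4 N + 1] of the first sum and the zeta value itself. *)
pose X M : R :=
  \sum_(0 <= m < M) logpow_coef k.+1 m.+1 * gamma01_partial N%:R m (4 * N).+2.
have cX : (fun M => `|X M - Y|) @ \oo --> `|zeta R k.+2 - ratr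
    (\sum_(0 <= n < (4 * N).+1) gen_stirling2 k.+2 n / n.+1%:R * N%:R ^+ n.+1) - Y|.
  apply: cvg_norm; apply: cvgB; last exact: cvg_cst.
  exact: cvg_zeta_sub_gen_stirling2_sum.
(* The estimate is uniform in [M], hence survives the limit. *)
apply: (cvgr_to_le cX); exists N.-1 => // M /= NM.
exact: truncation_error.
Qed.
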